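(* Let $\Gamma$ be a general network and let $\delta$ be the congruence on $\mathcal{L}(\Gamma)$ relating two elements exactly when they have the same tensor set. Then each $\delta$-class of $\mathcal{L}(\Gamma)$ contains local minimum elements (i.e. at least one local minimum element).
   Context: A general network $\Gamma$ has a finite vertex set $\Gamma^0$ and a finite set $T$ of tensors. A tensor $t=T_A^B$ is given by a non-empty set $A\subseteq\Gamma^0$ of covariant indexes and a (possibly empty) set $B\subseteq\Gamma^0$ of contra-variant indexes; its index set is $I(t)=A\cup B$. A 2-chain is an unordered pair $\oplus(t_i,t_j)$ of distinct tensors $t_i,t_j\in T$ with $I(t_i)\cap I(t_j)\neq\emptyset$. A (non-empty) tensor chain is $\oplus(P|S)$, where $P\subseteq T$ is non-empty, $S$ is a set of 2-chains between elements of $P$, and the pair is connected: any two distinct $t_i,t_j\in P$ are joined by a sequence $t_i=t_{k_1},\dots,t_{k_m}=t_j$ in $P$ with $\oplus(t_{k_\ell},t_{k_{\ell+1}})\in S$ for all $1\le \ell<m$. A tensor chain is determined by $(P,S)$; a single tensor $t$ is the chain with $P=\{t\}$, $S=\varnothing$. $\mathcal{L}(\Gamma)$ is the set of all non-empty tensor chains together with an extra element $\emptyset$ (the empty relation), whose tensor set is regarded as empty. Reducing: for non-empty chains $l_1=\oplus(P_1|S_1)$, $l_2=\oplus(P_2|S_2)$, put $l_1\mathring{\cup}l_2=\oplus(P_1\cup P_2|S_1\cup S_2)$ if $P_1\cap P_2\neq\varnothing$ and $l_1\mathring{\cup}l_2=\emptyset$ otherwise; also $\emptyset\mathring{\cup}l=l\mathring{\cup}\emptyset=\emptyset$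 for all $l$. Partial order: $l_1\preceq l_2$ if $l_1\mathring{\cup}l_2=l_2$. $l\delta$ denotes the $\delta$-class of $l$. An element $l\in\mathcal{L}(\Gamma)$ is a local minimum element of $l\delta$ if for every $l'\in l\delta$ with $l'\preceq l$ we have $l'=l$. *)

(* Defs.v *)
From HB Require Import structures.
From mathcomp Require Import all_boot.

Set Implicit Arguments.
Unset Strict Implicit.
Unset Printing Implicit Defensive.

(* Tensors are named by a finite type, so two distinct tensors of the network
   may carry the same index sets [cov] and [contra]. *)
Record network := Network {
  vertex : finType;
  tensor : finType;
  cov : tensor -> {set vertex};
  contra : tensor -> {set vertex};
  cov_neq0 : forall t, cov t != set0
}.

Section Chains.

Variable G : network.
Local Notation T := (tensor G).

Definition index_set (t : T) : {set vertex G} := cov t :|: contra t.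

(* The 2-chain on [t1] and [t2] is encoded as the pair-set [set t1; t2]. *)
Definition is_2chain (e : {set T}) : bool :=
  [exists t1, exists t2,
    [&& e == [set t1; t2], t1 != t2 &
        index_set t1 :&: index_set t2 != set0]].

Definition linked (P : {set T}) (E : {set {set T}}) : rel T :=
  [rel t1 t2 | [&& t1 \in P, t2 \in P & [set t1; t2] \in E]].

Definition is_chain (PE : {set T} * {set {set T}}) : bool :=
  let: (P, E) := PE in
  [&& P != set0,
      [forall e in E, is_2chain e && (e \subset P)] &
      [forall t1 in P, forall t2 in P, connect (linked P E) t1 t2]].

Record chain := Chain {
  chain_data :> {set T} * {set {set T}};
  chain_dataP : is_chain chain_data
}.

HB.instance Definition _ := [isSub for chain_data].
HB.instance Definition _ := [Finite of chain by <:].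

Definition chain_tensors (c : chain) : {set T} := c.1.
Definition chain_links (c : chain) : {set {set T}} := c.2.

Lemma chain_unionP (c1 c2 : chain) :
  chain_tensors c1 :&: chain_tensors c2 != set0 ->
  is_chain (chain_tensors c1 :|: chain_tensors c2,
            chain_links c1 :|: chain_links c2).
Proof.
case: c1 c2 => [[P1 E1] c1P] [[P2 E2] c2P]; rewrite /chain_tensors /chain_links /=.
case/and3P: c1P => P1n0 /forall_inP E1P /forall_inP con1.
case/and3P: c2P => _ /forall_inP E2P /forall_inP con2.
case/set0Pn => t0 /setIP[t01 t02]; apply/and3P; split.
- by apply/set0Pn; exists t0; rewrite inE t01.
- apply/forall_inP => e /setUP[/E1P | /E2P] /andP[-> /subset_trans]; apply.
    exact: subsetUl.
  exact: subsetUr.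
set r := linked _ _.
have sub1 t1 t2 : connect (linked P1 E1) t1 t2 -> connect r t1 t2.
  apply: connect_sub => x y /and3P[xP yP xyE]; apply: connect1.
  by rewrite /r /linked /= !inE xP yP xyE.
have sub2 t1 t2 : connect (linked P2 E2) t1 t2 -> connect r t1 t2.
  apply: connect_sub => x y /and3P[xP yP xyE]; apply: connect1.
  by rewrite /r /linked /= !inE xP yP xyE !orbT.
have to0 t : t \in P1 :|: P2 -> connect r t t0 && connect r t0 t.
  case/setUP => tP; apply/andP; split.
  - by apply: sub1; move/forall_inP: (con1 _ tP); apply.
  - by apply: sub1; move/forall_inP: (con1 _ t01); apply.
  - by apply: sub2; move/forall_inP: (con2 _ tP); apply.
  - by apply: sub2; move/forall_inP: (con2 _ t02); apply.
apply/forall_inP => t1 /to0/andP[t10 _].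
apply/forall_inP => t2 /to0/andP[_ t20].
exact: connect_trans t10 t20.
Qed.

Definition chain_union (c1 c2 : chain)
    (meet : chain_tensors c1 :&: chain_tensors c2 != set0) : chain :=
  Chain (chain_unionP meet).

(* L(G): [None] is the extra element, the empty relation. *)
Definition relations : finType := option chain.

Definition tensors (l : relations) : {set T} :=
  if l is Some c then chain_tensors c else set0.

Definition reduce (l1 l2 : relations) : relations :=
  match l1, l2 with
  | Some c1, Some c2 =>
      match @idP (chain_tensors c1 :&: chain_tensors c2 != set0) with
      | ReflectT meet => Some (chain_union meet)
      | ReflectF _ => None
      end
  | _, _ => None
  end.

Definition preceq (l1 l2 : relations) : bool := reduce l1 l2 == l2.

Definition delta : rel relations := [rel l1 l2 | tensors l1 == tensors l2].

Lemma delta_equiv : equivalence_rel delta.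
Proof. by move=> x y z; split=> [|/eqP xy]; rewrite /delta /= ?eqxx ?xy. Qed.

Lemma tensors_reduce (l1 l2 : relations) :
  tensors (reduce l1 l2) =
  if tensors l1 :&: tensors l2 != set0 then tensors l1 :|: tensors l2 else set0.
Proof.
case: l1 l2 => [c1|] [c2|] /=; rewrite ?set0I ?setI0 ?eqxx //.
by case: {-}_ / idP => [meet|/negP/negbTE nmeet]; rewrite ?meet ?nmeet.
Qed.

Lemma delta_congr (l1 l2 m1 m2 : relations) :
  delta l1 m1 -> delta l2 m2 -> delta (reduce l1 l2) (reduce m1 m2).
Proof. by move=> /eqP e1 /eqP e2; rewrite /delta /= !tensors_reduce e1 e2. Qed.

Definition delta_class (l : relations) : {set relations} :=
  [set l' | delta l l'].

Definition local_minimum (l : relations) : Prop :=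
  forall l', l' \in delta_class l -> preceq l' l -> l' = l.

End Chains.

(* Main.v *)
Require Import Defs.
From mathcomp Require Import all_boot.

(** Within a delta-class the order is inclusion of link sets, so an element of
    the class with the fewest links is a local minimum. *)

(** By finiteness a class has a member with fewest links. Unless it is [None], the links of any
    class member below it are among its own ([preceq_links]), so by minimality they coincide;
    tensors and links determine a relation ([relations_ext]). *)

Definition links {G : network} (l : relations G) : {set {set tensor G}} :=
  if l is Some c then chain_links c else set0.

Lemma chain_tensors_neq0 (G : network) (c : chain G) : chain_tensors c != set0.
Proof. by rewrite /chain_tensors; case: c => [[P E] cP] /=; case/and3P: cP. Qed.

Lemma tensors_eq0 (G : network) (l : relations G) :
  (tensors l == set0) = (l == None).
Proof. by case: l => [c|] /=; rewrite ?eqxx // (negbTE (chain_tensors_neq0 _ c)). Qed.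

Lemma relations_ext (G : network) (l1 l2 : relations G) :
  tensors l1 = tensors l2 -> links l1 = links l2 -> l1 = l2.
Proof.
case: l1 l2 => [c1|] [c2|] //= => [eq_P eq_E|/eqP|/esym/eqP].
- congr Some; apply: val_inj; move: eq_P eq_E.
  by rewrite /chain_tensors /chain_links /=; case: (chain_data c1) (chain_data c2)
     => [P1 E1] [P2 E2] /= -> ->.
- by rewrite (negbTE (chain_tensors_neq0 _ c1)).
- by rewrite (negbTE (chain_tensors_neq0 _ c2)).
Qed.

(* The hypothesis excludes [l2 = None], for which [preceq l1 None] always holds. *)
Lemma preceq_links (G : network) (l1 l2 : relations G) :
  l2 != None -> preceq l1 l2 -> links l1 \subset links l2.
Proof.
case: l1 l2 => [c1|] [c2|] //= _.
(* Disjoint tensor sets would reduce to [None], not to [Some c2]. *)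
rewrite /preceq /=; case: {-}_ / idP => // meet /eqP[<-].
exact: subsetUl.
Qed.

Theorem proposition4p4 (G : network) (l : relations G) :
  exists m : relations G, m \in delta_class l /\ local_minimum m.
Proof.
have l_l : l \in delta_class l by rewrite inE /delta /= eqxx.
case: (@arg_minnP _ l [in delta_class l] (fun m => #|links m|) l_l) => m /= lm min_m.
exists m; split=> // l'; rewrite inE /= => /eqP m_l' le_l'm.
apply: relations_ext; first by rewrite m_l'.
(* The empty relation is alone in its class. *)
have [m0|m_n0] := eqVneq m None.
  by move/esym/eqP: m_l'; rewrite m0 /= tensors_eq0 => /eqP ->.
apply/eqP; rewrite eqEcard preceq_links //=; apply: min_m.
by move: lm; rewrite !inE /delta /= m_l'.
Qed.
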